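(* Let $\gamma>0$ and let $\Omega\subset\mathbb{R}^N$ be a Lipschitz domain with $0\in\partial\Omega$, whose boundary is smooth around the origin, and such that $\Omega\subset P_\gamma$. If $N\ge 3$, then there exists a constant $C(\Omega,\gamma)>0$ such that for all $v\in H_0^1(\Omega)$, $$\int_\Omega|\nabla v|^2\,dx-\frac{N^2}{4}\int_\Omega\frac{v^2}{|x|^2}\,dx\ \ge\ C(\Omega,\gamma)\int_\Omega\frac{v^2}{|x|}\,dx .$$ If $N=2$, then for all $v\in H_0^1(\Omega)$, $$\int_\Omega|\nabla v|^2\,dx\ \ge\ \frac{N^2}{4}\int_\Omega\frac{v^2}{|x|^2}\,dx .$$
   Context: Points of $\mathbb{R}^N$ are written $x=(x',x_N)$ with $x'=(x_1,\dots,x_{N-1})$. For $\gamma\in\mathbb{R}$, $P_\gamma=\{x=(x',x_N)\in\mathbb{R}^N : x_N>\gamma|x'|^2\}$. *)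

(* Defs.v *)
From HB Require Import structures.
From mathcomp Require Import all_boot all_order all_algebra.
From mathcomp Require Import all_classical all_reals all_analysis.

Set Implicit Arguments.
Unset Strict Implicit.
Unset Printing Implicit Defensive.

Import Order.TTheory GRing.Theory Num.Theory.
Import numFieldNormedType.Exports.

Local Open Scope classical_set_scope.
Local Open Scope ring_scope.

Definition measure_matrix_display : measure_display -> measure_display.
Proof. exact. Qed.

Section measurable_matrix.
Context {d} {T : measurableType d} (m n : nat).

(* The product sigma-algebra: the coarsest one for which all the entries are
   measurable; for T = R it is the Borel sigma-algebra. *)
Definition measurable_mx : set_system 'M[T]_(m, n) :=
  <<s \bigcup_ij preimage_set_system setT
        (fun M : 'M[T]_(m, n) => M ij.1 ij.2) measurable >>.

Let measurable_mx0 : measurable_mx set0.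
Proof. exact: sigma_algebra0. Qed.

Let measurable_mxC A : measurable_mx A -> measurable_mx (~` A).
Proof. exact: sigma_algebraC. Qed.

Let measurable_mx_bigcup (F : (set 'M[T]_(m, n))^nat) :
  (forall i, measurable_mx (F i)) -> measurable_mx (\bigcup_i F i).
Proof. exact: sigma_algebra_bigcup. Qed.

HB.instance Definition _ := @isMeasurable.Build (measure_matrix_display d)
  'M[T]_(m, n) measurable_mx measurable_mx0 measurable_mxC measurable_mx_bigcup.

Lemma measurable_fun_mxP d' (S : measurableType d') (f : S -> 'M[T]_(m, n)) :
  measurable_fun setT f <->
  forall i j, measurable_fun setT (fun x => f x i j).
Proof.
split=> [mf i j|mf].
  move=> _ Y mY; rewrite setTI.
  have := mf measurableT ((fun M : 'M[T]_(m, n) => M i j) @^-1` Y).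
  rewrite setTI; apply; apply: sub_sigma_algebra; exists (i, j) => //.
  by exists Y => //; rewrite setTI.
move=> _; apply: (@measurability _ _ _ _ _ _
  (\bigcup_ij preimage_set_system setT
        (fun M : 'M[T]_(m, n) => M ij.1 ij.2) measurable)) => //.
move=> _ [_ [[i j] _ [Y mY <-]] <-] /=.
by rewrite setTI setTI; have := mf i j measurableT Y mY; rewrite setTI.
Qed.

End measurable_matrix.

Section lebesgue_rV.
Context {R : realType}.

Definition cons_rV n (p : R * 'rV[R]_n) : 'rV[R]_n.+1 := row_mx p.1%:M p.2.

(* The n-dimensional Lebesgue measure, as an iterated product measure. *)
Fixpoint lebesgue_rV n : set 'rV[R]_n -> \bar R :=
  match n with
  | 0%N => \d_(0 : 'rV[R]_0)
  | n'.+1 => pushforward (lebesgue_measure \x @lebesgue_rV n')%E (@cons_rV n')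
  end.

Lemma cons_rV0 n (p : R * 'rV[R]_n) : cons_rV p 0 ord0 = p.1.
Proof.
by rewrite mxE; case: splitP => // k _; rewrite mxE ord1 eqxx.
Qed.

Lemma cons_rVS n (p : R * 'rV[R]_n) j : cons_rV p 0 (lift ord0 j) = p.2 0 j.
Proof.
rewrite mxE; case: splitP => [[[]]//|k /=].
by rewrite /bump/= !add1n => -[/val_inj ->].
Qed.

Lemma measurable_cons_rV n : measurable_fun setT (@cons_rV n).
Proof.
apply/measurable_fun_mxP => i j; rewrite (ord1 i).
case: (unliftP ord0 j) => [k ->|->].
- under eq_fun do rewrite cons_rVS.
  apply: (@measurableT_comp _ _ _ _ _ _ (fun M : 'rV[R]_n => M 0 k)) => //.
  by have /measurable_fun_mxP := @measurable_id _ 'rV[R]_n setT; exact.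
- by under eq_fun do rewrite cons_rV0; exact: measurable_fst.
Qed.

Lemma bijective_cons_rV n : bijective (@cons_rV n).
Proof.
exists (fun M : 'rV[R]_n.+1 => (M 0 ord0, \row_j M 0 (lift ord0 j)))
  => [[x y]|M].
- rewrite cons_rV0; congr pair; apply/rowP => j.
  by rewrite mxE cons_rVS.
- apply/rowP => j; case: (unliftP ord0 j) => [k ->|->].
  + by rewrite cons_rVS mxE.
  + by rewrite cons_rV0.
Qed.

End lebesgue_rV.

Section lebesgue_rV_sigma_finite.
Local Open Scope ereal_scope.
Context {R : realType} (n : nat).
Variable m : {sigma_finite_measure set 'rV[R]_n -> \bar R}.

Let step := pushforward (lebesgue_measure \x m) (@cons_rV R n).

Let measurable_preimage A : measurable A -> measurable (@cons_rV R n @^-1` A).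
Proof. by rewrite -[X in _ -> measurable X]setTI; exact: measurable_cons_rV. Qed.

Let step0 : step set0 = 0.
Proof. by rewrite /step /pushforward preimage_set0 measure0. Qed.

Let step_ge0 A : 0 <= step A.
Proof. by rewrite /step /pushforward; exact: measure_ge0. Qed.

Let step_sigma_additive : semi_sigma_additive step.
Proof.
move=> F mF tF mUF; rewrite /step /pushforward preimage_bigcup.
apply: measure_semi_sigma_additive.
- by move=> i; exact: measurable_preimage.
- apply/trivIsetP => /= i j _ _ ij; rewrite -preimage_setI.
  by move/trivIsetP : tF => /(_ _ _ _ _ ij) ->//; rewrite preimage_set0.
- by rewrite -preimage_bigcup; exact: measurable_preimage.
Qed.

HB.instance Definition _ :=
  isMeasure.Build _ _ _ step step0 step_ge0 step_sigma_additive.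

Let step_sigma_finite : sigma_finite setT step.
Proof.
have [F FT Foo] : sigma_finite setT (lebesgue_measure \x m).
  have /sigma_finiteP[G [GT ndG Goo]] := sigma_finiteT (@lebesgue_measure R).
  have /sigma_finiteP[H [HT ndH Hoo]] := sigma_finiteT m.
  exists (fun k => G k `*` H k) => [|k].
    rewrite -setXTT GT HT; apply/seteqP; split=> [[x y] /= [[i _ Gx] [j _ Hy]]|].
      exists (maxn i j) => //; split => /=.
      + by move: x Gx; exact/subsetPset/ndG/leq_maxl.
      + by move: y Hy; exact/subsetPset/ndH/leq_maxr.
    by move=> [x y] [k _ [/= Gx Hy]]; split; exists k.
  have [mG Gk] := Goo k; have [mH Hk] := Hoo k.
  split; first exact: measurableX.
  by rewrite product_measure1E// lte_mul_pinfty// ge0_fin_numE.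
have [g fK gK] := bijective_cons_rV (R := R) n.
have mg : measurable_fun setT g.
  rewrite (_ : g = fun M : 'rV[R]_n.+1 =>
      (M 0%R ord0, \row_j M 0%R (lift ord0 j))%R); last first.
    apply/funext => M; apply: (can_inj fK); rewrite gK.
    apply/rowP => j; case: (unliftP ord0 j) => [k ->|->].
    + by rewrite cons_rVS mxE.
    + by rewrite cons_rV0.
  have mcoord (j : 'I_n.+1) : measurable_fun setT (fun M : 'rV[R]_n.+1 => M 0%R j).
    by have /measurable_fun_mxP := @measurable_id _ 'rV[R]_n.+1 setT; exact.
  apply/measurable_fun_pair => //=.
  apply/measurable_fun_mxP => i j; under eq_fun do rewrite mxE.
  exact: mcoord.
exists (fun k => g @^-1` F k) => [|k].
  by rewrite -preimage_bigcup -FT preimage_setT.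
have [mF Fk] := Foo k; split.
  by have := mg measurableT _ mF; rewrite setTI.
rewrite /step /pushforward -comp_preimage.
by rewrite (_ : g \o _ = id)//; apply/funext => x /=; rewrite fK.
Qed.

HB.instance Definition _ :=
  Measure_isSigmaFinite.Build _ _ _ step step_sigma_finite.

Definition lebesgue_rV_step : {sigma_finite_measure set 'rV[R]_n.+1 -> \bar R} :=
  step.

End lebesgue_rV_sigma_finite.

Section lebesgue_rV_instances.
Context {R : realType} (n : nat).

Lemma lebesgue_rV_sigma_finite_measure :
  {m : {sigma_finite_measure set 'rV[R]_n -> \bar R} |
    m = @lebesgue_rV R n :> (set _ -> _)}.
Proof.
elim: n => [|k [m mE]] /=; first by exists (\d_(0 : 'rV[R]_0)).
by exists (lebesgue_rV_step m); rewrite -mE.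
Qed.

Let leb0 : @lebesgue_rV R n set0 = 0%E.
Proof. by have [m <-] := lebesgue_rV_sigma_finite_measure. Qed.

Let leb_ge0 A : (0 <= @lebesgue_rV R n A)%E.
Proof. by have [m <-] := lebesgue_rV_sigma_finite_measure. Qed.

Let leb_sigma_additive : semi_sigma_additive (@lebesgue_rV R n).
Proof.
have [m <-] := lebesgue_rV_sigma_finite_measure.
exact: measure_semi_sigma_additive.
Qed.

HB.instance Definition _ := isMeasure.Build _ _ _ (@lebesgue_rV R n)
  leb0 leb_ge0 leb_sigma_additive.

Let leb_sigma_finite : sigma_finite setT (@lebesgue_rV R n).
Proof.
have [m <-] := lebesgue_rV_sigma_finite_measure; exact: sigma_finiteT.
Qed.

HB.instance Definition _ := Measure_isSigmaFinite.Build _ _ _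
  (@lebesgue_rV R n) leb_sigma_finite.

Lemma lebesgue_rV_cons (B : set R) (C : set 'rV[R]_n) :
  measurable B -> measurable C ->
  lebesgue_rV [set x : 'rV[R]_n.+1 |
    B (x 0 ord0) /\ C (\row_j x 0 (lift ord0 j))] =
  (lebesgue_measure B * lebesgue_rV C)%E.
Proof.
move=> mB mC; rewrite -product_measure1E//= /pushforward; congr (_ \x _)%E.
apply/seteqP; split=> -[x y] /=; rewrite cons_rV0.
  by rewrite (_ : \row_j _ = y)//; apply/rowP => j; rewrite mxE cons_rVS.
by rewrite (_ : \row_j _ = y)//; apply/rowP => j; rewrite mxE cons_rVS.
Qed.

End lebesgue_rV_instances.

Lemma lebesgue_rV_box {R : realType} n (B : 'I_n -> set R) :
  (forall i, measurable (B i)) ->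
  lebesgue_rV [set x : 'rV[R]_n | forall i, B i (x 0 i)] =
  (\prod_(i < n) lebesgue_measure (B i))%E.
Proof.
elim: n B => [|n IH] B mB.
  by rewrite big_ord0 /= diracE mem_set// => -[].
rewrite big_ord_recl -IH// -lebesgue_rV_cons//.
  congr lebesgue_rV; apply/seteqP; split=> x /=.
    by move=> xB; split=> // i; rewrite mxE.
  move=> [x0 xB] i; case: (unliftP ord0 i) => [j ->|->//].
  by have := xB j; rewrite mxE.
rewrite (_ : mkset _ = \bigcap_(i in [set: 'I_n])
    ((fun x : 'rV[R]_n => x 0 i) @^-1` B (lift ord0 i))); last first.
  by apply/seteqP; split=> x /= xB i; [move=> _|]; exact: xB.
apply: fin_bigcap_measurable; first exact: finite_finset.
move=> i _; rewrite -[X in measurable X]setTI.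
have /measurable_fun_mxP/(_ 0 i) := @measurable_id _ 'rV[R]_n setT.
by apply.
Qed.

Section geometry.
Context {R : realType}.

(* The norm [`|x|] of the library on row vectors is the sup norm. *)
Definition enorm n (x : 'rV[R]_n) : R := Num.sqrt (\sum_i x 0 i ^+ 2).

(* [x = (x', x_N)] with [x' = init_rV x] and [x_N = last_rV x]. *)
Definition init_rV n (x : 'rV[R]_n.+1) : 'rV[R]_n :=
  \row_j x 0 (widen_ord (leqnSn n) j).

Definition last_rV n (x : 'rV[R]_n.+1) : R := x 0 ord_max.

Definition paraboloid n (gamma : R) : set 'rV[R]_n.+1 :=
  [set x | gamma * enorm (init_rV x) ^+ 2 < last_rV x].

Definition boundary n (Omega : set 'rV[R]_n) : set 'rV[R]_n :=
  closure Omega `\` interior Omega.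

(* Continuous differentiability of order k through partial derivatives. *)
Fixpoint Ck n (k : nat) (f : 'rV[R]_n -> R) : Prop :=
  continuous f /\
  match k with
  | 0%N => True
  | k'.+1 => forall i : 'I_n,
      (forall x, derivable f x (delta_mx 0 i)) /\ Ck k' ('D_(delta_mx 0 i) f)
  end.

Definition smooth n (f : 'rV[R]_n -> R) : Prop := forall k, Ck k f.

(* Near p, in suitable orthonormal coordinates [y = x *m A], Omega is the
   region above the graph of a function of class [C]; a translation of the
   coordinates is absorbed by the function. *)
Definition local_epigraph n (C : set ('rV[R]_n -> R))
    (Omega : set 'rV[R]_n.+1) (p : 'rV[R]_n.+1) : Prop :=
  exists (A : 'M[R]_n.+1) (psi : 'rV[R]_n -> R),
    [/\ A *m A^T = 1%:M, C psi &
        \forall x \near p,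
          Omega x <-> psi (init_rV (x *m A)) < last_rV (x *m A)].

Definition domain n (Omega : set 'rV[R]_n) : Prop :=
  [/\ open Omega, connected Omega & Omega !=set0].

Definition lipschitz_domain n (Omega : set 'rV[R]_n.+1) : Prop :=
  domain Omega /\
  forall p, boundary Omega p ->
    local_epigraph [set psi | lipschitz psi] Omega p.

Definition smooth_boundary_near n (Omega : set 'rV[R]_n.+1)
    (p : 'rV[R]_n.+1) : Prop :=
  local_epigraph (@smooth n) Omega p.

End geometry.

Section sobolev.
Context {R : realType} (n : nat).
Local Notation mu := (@lebesgue_rV R n).
Implicit Types (Omega : set 'rV[R]_n) (v : 'rV[R]_n -> R)
  (g : 'rV[R]_n -> 'rV[R]_n).

Definition grad (phi : 'rV[R]_n -> R) (x : 'rV[R]_n) : 'rV[R]_n :=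
  \row_i 'D_(delta_mx 0 i) phi x.

(* C_c^oo(Omega) *)
Definition test_function Omega (phi : 'rV[R]_n -> R) : Prop :=
  let supp := closure [set x | phi x != 0] in
  [/\ smooth phi, compact supp & supp `<=` Omega].

Definition inL2 Omega v : Prop :=
  measurable_fun Omega v /\ (\int[mu]_(x in Omega) (v x ^+ 2)%:E < +oo)%E.

Definition weak_gradient Omega v g : Prop :=
  forall (phi : 'rV[R]_n -> R) (i : 'I_n), test_function Omega phi ->
    (\int[mu]_(x in Omega) (v x * grad phi x 0 i)%:E =
     - \int[mu]_(x in Omega) (g x 0 i * phi x)%:E)%E.

(* v is in H^1(Omega), with weak gradient g. *)
Definition inH1 Omega v g : Prop :=
  [/\ inL2 Omega v, forall i, inL2 Omega (fun x => g x 0 i) &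
      weak_gradient Omega v g].

(* v is in H^1_0(Omega), the closure of C_c^oo(Omega) in H^1(Omega), with weak
   gradient g. *)
Definition inH10 Omega v g : Prop :=
  inH1 Omega v g /\
  exists phi : ('rV[R]_n -> R)^nat,
    (forall k, test_function Omega (phi k)) /\
    (\int[mu]_(x in Omega)
       ((phi k x - v x) ^+ 2 + enorm (grad (phi k) x - g x) ^+ 2)%:E
     @[k --> \oo] --> 0)%E.

End sobolev.

(* Main.v *)
Require Import Defs.
From mathcomp Require Import all_boot all_order all_algebra.
From mathcomp Require Import all_classical all_reals all_analysis.
From mathcomp Require Import measurable_realfun ring lra.
Import Order.TTheory GRing.Theory Num.Theory.
Import numFieldNormedType.Exports.
Local Open Scope classical_set_scope.
Local Open Scope ring_scope.

(** The inequality comes from an explicit positive supersolution. With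
    h(x) = x_N - gamma |x'|^2, which is positive exactly on the paraboloid, put
    phi = h |x|^(-N/2). In the half-space (gamma = 0) this phi solves
    - Laplacian phi = (N^2/4) phi / |x|^2, and the curvature of the paraboloid
    only adds a favourable term:

      - Laplacian phi / phi
          = N^2 / (4 |x|^2) + gamma (2 (N - 1) - N |x'|^2 / |x|^2) / h
         >= N^2 / (4 |x|^2) + gamma (N - 2) / |x|,

    because |x'| <= |x| and 0 < h <= |x|. So the constant is
    C = gamma (N - 2), and for N = 2 the remainder degenerates to 0.

    The proof works with the vector field F = - grad phi / phi
    = N x / (2 |x|^2) - grad h / h, for which div F - |F|^2 is
    - Laplacian phi / phi ([div_field_sub_sqr], [weight_le_div_field]).
    Expanding |grad w + w F|^2 >= 0 gives
    |grad w|^2 + div (w^2 F) >= (div F - |F|^2) w^2, and the divergence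
    integrates to zero when w is a test function ([hardy_test_function]): F is
    smooth on the paraboloid, so w^2 F is a compactly supported C^1 field, each
    partial derivative of which has integral zero by Fubini and the fundamental
    theorem of calculus ([integral_derive0]).

    The inequality passes to H^1_0 in [hardy_H10]. The weight is unbounded near
    the origin, so it is first truncated at a level M: the truncated
    left-hand side is continuous for the H^1 norm, and monotone convergence
    then lets M tend to infinity. *)

Set Implicit Arguments.
Unset Strict Implicit.
Unset Printing Implicit Defensive.

(** * Open sets and continuous functions are measurable *)

Section borel_rV.
Context {R : realType} {n : nat}.
Implicit Types (U : set 'rV[R]_n) (x : 'rV[R]_n).

Lemma measurable_coord (i : 'I_n) :
  measurable_fun setT (fun x : 'rV[R]_n => x 0 i).
Proof.
by have /measurable_fun_mxP := @measurable_id _ 'rV[R]_n setT; exact.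
Qed.

Lemma measurable_box (B : 'I_n -> set R) : (forall i, measurable (B i)) ->
  measurable [set x : 'rV[R]_n | forall i, B i (x 0 i)].
Proof.
move=> mB; rewrite (_ : mkset _ = \bigcap_(i in [set: 'I_n])
    ((fun x : 'rV[R]_n => x 0 i) @^-1` B i)); last first.
  by apply/seteqP; split=> x /= xB i; [move=> _|]; exact: xB.
apply: fin_bigcap_measurable; first exact: finite_finset.
by move=> i _; rewrite -[X in measurable X]setTI; exact: measurable_coord.
Qed.

(** The sigma-algebra on row vectors is a product one, unrelated a priori to the
    topology; an open set is the union of the countably many balls with rational
    centre and radius 1/(k+1) that it contains. *)
Lemma open_measurable_rV U : open U -> measurable U.
Proof.
move=> oU.
pose B (p : 'rV[rat]_n * nat) : set 'rV[R]_n :=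
  [set x | forall i, ball (ratr (p.1 0 i) : R) p.2.+1%:R^-1 (x 0 i)].
rewrite (_ : U = \bigcup_p (if `[< B p `<=` U >] then B p else set0)).
  apply: countable_bigcupT_measurable => // p.
  case: asboolP => // _; 
  apply: (@measurable_box (fun i => ball (ratr (p.1 0 i) : R) p.2.+1%:R^-1)) => i.
  exact: measurable_ball.
apply/seteqP; split=> [x Ux|x [p _]]; last first.
  by case: asboolP => // BU Bx; exact: BU.
have /nbhs_ballP[e /= e0 eU] : nbhs x U by exact: open_nbhs_nbhs.
have [d [d0 de [k dE]]] :
    exists d : R, [/\ 0 < d, d < e / 2 & exists k, d = k.+1%:R^-1].
  have e20 : 0 < e / 2 by rewrite divr_gt0.
  have [k _ ke] := near_infty_natSinv_lt (PosNum e20).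
  exists k.+1%:R^-1; split; [by rewrite invr_gt0|exact: ke (leqnn k)|].
  by exists k.
have [q qx] : {q : 'I_n -> rat & forall i, ball (ratr (q i) : R) d (x 0 i)}.
  apply: (@boolp.choice _ _ (fun i q => ball (ratr q : R) d (x 0 i))) => i.
  have /rat_in_itvoo[q] : x 0 i - d < x 0 i + d by lra.
  rewrite in_itv /= => /andP[q1 q2]; exists q; rewrite /ball /= ltr_norml.
  by apply/andP; split; lra.
exists (\row_i q i, k) => //; case: asboolP => [_ i|]; first by rewrite /= mxE -dE.
case=> y /= By; apply: eU; split=> // i j; rewrite ord1.
have := By j; have := qx j; rewrite /ball /= mxE -dE !ltr_norml.
move=> /andP[? ?] /andP[? ?]; apply/andP; split; lra.
Qed.

Lemma continuous_measurable_rV U (f : 'rV[R]_n -> R) :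
  open U -> {in U, continuous f} -> measurable_fun U f.
Proof.
move=> oU cf; apply: (measurability _ (RGenOpens.measurableE R)).
move=> _ [_ [a [b ->] <-]]; apply: open_measurable_rV.
rewrite openE => x [Ux fx]; rewrite /interior; apply: filterI.
  exact: open_nbhs_nbhs.
by apply: (cf x (mem_set Ux)); apply: open_nbhs_nbhs; split.
Qed.

Lemma continuous_measurableT_rV (f : 'rV[R]_n -> R) :
  continuous f -> measurable_fun setT f.
Proof.
by move=> cf; apply: continuous_measurable_rV => [|x _]; [exact: openT|exact: cf].
Qed.

End borel_rV.

(** * Fubini along one coordinate *)

Section fubini_rV.
Context {R : realType}.

(** Replacing one coordinate parametrises the line through [x] parallel to an
    axis, without reordering the coordinates of the iterated measure. *)
Definition set_coord {n} (x : 'rV[R]_n) (i : 'I_n) (t : R) : 'rV[R]_n :=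
  \row_j (if j == i then t else x 0 j).

Lemma integrable_bounded_box n (f : 'rV[R]_n -> R) (M K : R) :
  measurable_fun setT f -> (forall x, `|f x| <= M) ->
  (forall x j, f x != 0 -> `|x 0 j| <= K) ->
  (@lebesgue_rV R n).-integrable setT (EFin \o f).
Proof.
move=> mf fM fK.
pose B := [set x : 'rV[R]_n | forall i, `[-K, K]%classic (x 0 i)].
have mB : measurable B by apply: (@measurable_box R n (fun=> `[-K, K]%classic)).
have Boo : (lebesgue_rV B < +oo)%E.
  rewrite (@lebesgue_rV_box R n (fun=> `[-K, K]%classic))//.
  under eq_bigr do rewrite lebesgue_measure_itv/=.
  case: ifP => _; last by rewrite prodEFin ltry.
  by under eq_bigr do rewrite -EFinB; rewrite prodEFin ltry.
have iB : (@lebesgue_rV R n).-integrable B (EFin \o f).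
  apply: measurable_bounded_integrable => //; first exact: measurable_funTS.
  exists M; split; first exact: num_real.
  by move=> y My x _ /=; exact: le_trans (fM x) (ltW My).
rewrite (_ : EFin \o f = (EFin \o f) \_ B).
  by apply/(integrable_restrict _ mB measurableT); rewrite setTI.
apply/funext => x; rewrite patchE; case: ifPn => //= xB; congr EFin.
apply/eqP/negPn/negP => fx; move: xB => /negP; apply; rewrite inE => i /=.
by rewrite in_itv/= -ler_norml; exact: fK.
Qed.

(** The Lebesgue measure lives on the copy of [R] generated by intervals, so the
    pushforward lemmas need the map typed from that copy. *)
Lemma measurable_cons_rV_itv n : @measurable_fun _ _
  (measurableTypeR R * 'rV[R]_n)%type 'rV[R]_n.+1 setT (@cons_rV R n).
Proof. exact: (@measurable_cons_rV R n). Qed.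

Lemma measurable_comp_cons_rV n (f : 'rV[R]_n.+1 -> R) : measurable_fun setT f ->
  measurable_fun setT (f \o @cons_rV R n).
Proof. by move=> mf; apply: measurableT_comp => //; exact: measurable_cons_rV. Qed.

Lemma integrable_cons_rV n (f : 'rV[R]_n.+1 -> R) :
  measurable_fun setT f -> (@lebesgue_rV R n.+1).-integrable setT (EFin \o f) ->
  (lebesgue_measure \x @lebesgue_rV R n)%E.-integrable setT
    (fun p => (f (cons_rV p))%:E).
Proof.
move=> mf /integrableP[_ foo]; apply/integrableP; split.
  by apply/measurable_EFinP; exact: measurable_comp_cons_rV.
move: foo; rewrite (@ge0_integral_pushforward _ _ _ _ _ _ (@measurable_cons_rV_itv n)
  ((lebesgue_measure \x @lebesgue_rV R n)%E : measure _ R))//.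
by do 2 apply: measurableT_comp => //.
Qed.

Lemma integral_cons_rV n (f : 'rV[R]_n.+1 -> R) :
  measurable_fun setT f -> (@lebesgue_rV R n.+1).-integrable setT (EFin \o f) ->
  (\int[@lebesgue_rV R n.+1]_x (f x)%:E =
   \int[lebesgue_measure \x @lebesgue_rV R n]_p (f (cons_rV p))%:E)%E.
Proof.
move=> mf intf; have intc := integrable_cons_rV mf intf.
rewrite [LHS](@integral_pushforward _ _ _ _ _ _ (@measurable_cons_rV_itv n)
  ((lebesgue_measure \x @lebesgue_rV R n)%E : measure _ R))//.
exact/measurable_EFinP.
Qed.

Lemma set_coord0 n (p : R * 'rV[R]_n) t :
  set_coord (cons_rV p) ord0 t = cons_rV (t, p.2).
Proof.
apply/rowP => j; rewrite mxE; case: (unliftP ord0 j) => [k ->|->].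
  by rewrite !cons_rVS.
by rewrite eqxx cons_rV0.
Qed.

Lemma set_coordS n (p : R * 'rV[R]_n) i t :
  set_coord (cons_rV p) (lift ord0 i) t = cons_rV (p.1, set_coord p.2 i t).
Proof.
apply/rowP => j; rewrite mxE; case: (unliftP ord0 j) => [k ->|->].
  by rewrite !cons_rVS mxE (inj_eq lift_inj).
by rewrite !cons_rV0.
Qed.

(** The measure integrates the first coordinate out of the product, so the axis
    [i] is reached by induction on the dimension: if [i] is the first
    coordinate, integrating it first gives 0; otherwise each slice at a fixed
    first coordinate vanishes by induction. The bound and the box make [f]
    integrable, and are inherited by slices. *)
Lemma integral_zero_fibers n (i : 'I_n) (f : 'rV[R]_n -> R) (M K : R) :
  measurable_fun setT f -> (forall x, `|f x| <= M) ->
  (forall x j, f x != 0 -> `|x 0 j| <= K) ->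
  (forall x, \int[lebesgue_measure]_t (f (set_coord x i t))%:E = 0)%E ->
  (\int[@lebesgue_rV R n]_x (f x)%:E = 0)%E.
Proof.
elim: n i f => [[]//|n IH] i f mf fM fK f0.
have intf := integrable_bounded_box mf fM fK.
rewrite integral_cons_rV//; have intc := integrable_cons_rV mf intf.
have mc := measurable_comp_cons_rV mf.
case: (unliftP ord0 i) => [j iE|iE]; subst i.
  rewrite -integral12_prod_meas1//; apply: integral0_eq => t _.
  apply: (IH j).
  - by apply: (measurableT_comp mc); exact: measurable_pair1.
  - by move=> x; exact: fM.
  - by move=> x k /fK => /(_ (lift ord0 k)); rewrite cons_rVS.
  - by move=> x; rewrite -(f0 (cons_rV (t, x))); apply: eq_integral => s _; rewrite set_coordS.
rewrite -integral21_prod_meas1//; apply: integral0_eq => x _.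
rewrite -(f0 (cons_rV (0, x))); apply: eq_integral => s _.
by rewrite set_coord0.
Qed.

End fubini_rV.

(** * Partial derivatives with compact support integrate to zero *)

Section compact_support.
Context {R : realType} {n : nat}.
Implicit Types (x : 'rV[R]_n) (A : set 'rV[R]_n).

Lemma ler_coord_norm x (j : 'I_n) : `|x 0 j| <= `|x|.
Proof.
rewrite [leRHS]/Num.norm /= mx_normrE; apply/bigmax_geP; right => /=.
by exists (0, j).
Qed.

Lemma compact_box A : compact A ->
  exists K : R, forall x j, A x -> `|x 0 j| <= K.
Proof.
move=> /compact_bounded[K [_ KA]]; exists (K + 1) => x j Ax.
by apply: le_trans (ler_coord_norm x j) (KA _ _ _ Ax); rewrite ltrDl.
Qed.

Lemma continuous_compact_supp_bounded A (f : 'rV[R]_n -> R) : compact A ->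
  continuous f -> (forall x, ~ A x -> f x = 0) -> exists M, forall x, `|f x| <= M.
Proof.
move=> cA cf fA0.
have /compact_bounded[M [_ MA]] : compact (f @` A).
  by apply: continuous_compact => //; exact: continuous_subspaceT.
exists (Num.max (M + 1) 0) => x; rewrite le_max; have [Ax|/fA0 ->] := pselect (A x).
  by rewrite (MA (M + 1)) ?ltrDl//; exists x.
by rewrite normr0 lexx orbT.
Qed.

Lemma integrable_compact_supp A (f : 'rV[R]_n -> R) : compact A ->
  continuous f -> (forall x, ~ A x -> f x = 0) ->
  (@lebesgue_rV R n).-integrable setT (EFin \o f).
Proof.
move=> cA cf fA0; have [M fM] := continuous_compact_supp_bounded cA cf fA0.
have [K AK] := compact_box cA.
apply: (integrable_bounded_box (M := M) (K := K)) => //.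
  exact: continuous_measurableT_rV.
move=> x j fx; apply: AK; apply: contrapT => /fA0 fx0.
by move: fx; rewrite fx0 eqxx.
Qed.

Lemma set_coordE x (i : 'I_n) t :
  set_coord x i t = (t - x 0 i) *: delta_mx 0 i + x.
Proof.
apply/rowP => j; rewrite !mxE eqxx /=; case: eqP => [->|_].
  by rewrite mulr1 subrK.
by rewrite mulr0 add0r.
Qed.

Lemma is_derive_set_coord (f : 'rV[R]_n -> R) x (i : 'I_n) (t df : R) :
  is_derive (set_coord x i t) (delta_mx 0 i) f df ->
  is_derive t 1 (fun s => f (set_coord x i s)) df.
Proof.
have E : (fun h : R => h^-1 *: (((fun s => f (set_coord x i s)) \o shift t) (h *: 1)
      - f (set_coord x i t)))
    = (fun h : R => h^-1 *: ((f \o shift (set_coord x i t)) (h *: delta_mx 0 i)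
      - f (set_coord x i t))).
  apply/funext => h /=; congr (_ *: (f _ - _)).
  by rewrite !set_coordE [h *: 1]mulr1 addrA -scalerDl addrA.
by move=> [fd <-]; split; rewrite /derivable /derive E.
Qed.

(** By the fundamental theorem of calculus on a segment whose ends lie outside
    the support, where the primitive [h] vanishes. *)
Lemma integral_line_derive0 A (h g : 'rV[R]_n -> R) (i : 'I_n) x : compact A ->
  continuous g -> (forall x, is_derive x (delta_mx 0 i) h (g x)) ->
  (forall x, ~ A x -> h x = 0 /\ g x = 0) ->
  (\int[lebesgue_measure]_t (g (set_coord x i t))%:E = 0)%E.
Proof.
move=> cA cg dh hg0; have [K AK] := compact_box cA.
(* Strictly beyond every coordinate of the support, and positive even if the
   bound K is negative. *)
pose L : R := `|K| + 1.
have L0 : 0 < L by rewrite ltr_wpDl.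
have far (t : R) : (t <= - L) || (L <= t) -> ~ A (set_coord x i t).
  move=> Lt /AK - /(_ i); rewrite mxE eqxx => tK.
  have {tK} : `|t| <= `|K| by exact: le_trans tK (ler_norm K).
  move: Lt; rewrite /L ler_norml; move: `|K| => k; lra.
have cline : continuous (set_coord x i).
  rewrite (_ : set_coord x i = fun t => (t - x 0 i) *: delta_mx 0 i + x).
    move=> t; apply: cvgD; last exact: cvg_cst.
    by apply: cvgZr_tmp; apply: cvgB; [exact: cvg_id|exact: cvg_cst].
  by apply/funext => t; rewrite set_coordE.
have cgl : continuous (fun t => g (set_coord x i t)).
  by move=> t; apply: continuous_comp; [exact: cline|exact: cg].
have dhl (t : R) : is_derive t 1 (fun s => h (set_coord x i s)) (g (set_coord x i t)).
  by apply: is_derive_set_coord; exact: dh.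
have chl : continuous (fun t => h (set_coord x i t)).
  move=> t; apply: differentiable_continuous; apply/derivable1_diffP.
  by have [] := dhl t.
transitivity (\int[lebesgue_measure]_(t in `[(- L)%R, L%R]) (g (set_coord x i t))%:E)%E.
  rewrite [RHS]integral_mkcond; apply: eq_integral => t _; rewrite patchE.
  case: ifPn => // /negP; rewrite inE /= in_itv /= => tL.
  have [] // := hg0 (set_coord x i t); last by move=> _ ->.
  apply: far; move: tL; case: (leP t (-L)) => //= t1.
  by case: (leP L t) => // t2 []; rewrite (ltW t1) (ltW t2).
rewrite (@continuous_FTC2 _ _ (fun t => h (set_coord x i t))).
- rewrite (hg0 _ (far L _)).1 ?lexx ?orbT// (hg0 _ (far (-L) _)).1 ?lexx//.
  by rewrite subee.
- by rewrite (@lt_trans _ _ 0)// oppr_lt0.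
- exact: continuous_subspaceT.
- split.
  + by move=> t _; have [] := dhl t.
  + exact/cvg_at_right_filter/chl.
  + exact/cvg_at_left_filter/chl.
- by move=> t _; rewrite derive1E; have [_ ->] := dhl t.
Qed.

Lemma integral_derive0 A (h g : 'rV[R]_n -> R) (i : 'I_n) : compact A ->
  continuous g -> (forall x, is_derive x (delta_mx 0 i) h (g x)) ->
  (forall x, ~ A x -> h x = 0 /\ g x = 0) ->
  (\int[@lebesgue_rV R n]_x (g x)%:E = 0)%E.
Proof.
move=> cA cg dh hg0.
have gA0 x : ~ A x -> g x = 0 by move=> /hg0[].
have [M gM] := continuous_compact_supp_bounded cA cg gA0.
have [K AK] := compact_box cA.
apply: (@integral_zero_fibers _ _ i _ M K) => //.
- exact: continuous_measurableT_rV.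
- move=> x j gx; apply: AK; apply: contrapT => /gA0 gx0.
  by move: gx; rewrite gx0 eqxx.
- by move=> x; exact: integral_line_derive0 cA cg dh hg0.
Qed.

End compact_support.

(** * The logarithmic gradient of the supersolution *)

Section continuity_rules.
Context {R : realType} {T : topologicalType}.
Implicit Types (f g : T -> R) (x : T).

Lemma continuous_at_add f g x : {for x, continuous f} -> {for x, continuous g} ->
  {for x, continuous (fun y => f y + g y)}.
Proof. by move=> cf cg; exact: cvgD. Qed.

Lemma continuous_at_sub f g x : {for x, continuous f} -> {for x, continuous g} ->
  {for x, continuous (fun y => f y - g y)}.
Proof. by move=> cf cg; exact: cvgB. Qed.

Lemma continuous_at_mul f g x : {for x, continuous f} -> {for x, continuous g} ->
  {for x, continuous (fun y => f y * g y)}.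
Proof. by move=> cf cg; exact: cvgM. Qed.

Lemma continuous_at_sqr f x : {for x, continuous f} ->
  {for x, continuous (fun y => f y ^+ 2)}.
Proof. by move=> cf; exact: cvgM. Qed.

Lemma continuous_at_inv f x : f x != 0 -> {for x, continuous f} ->
  {for x, continuous (fun y => (f y)^-1)}.
Proof. by move=> fx cf; exact: cvgV. Qed.

Lemma continuous_at_sum (I : Type) (r : seq I) (F : I -> T -> R) x :
  (forall i, {for x, continuous (F i)}) ->
  {for x, continuous (fun y => \sum_(i <- r) F i y)}.
Proof. by move=> cF; apply: cvg_big => [|i _]; [exact: add_continuous|exact: cF]. Qed.

End continuity_rules.

Section derivation_rules.
Context {R : realType} {V : normedModType R}.
Implicit Types (f g : V -> R) (x v : V).

Lemma is_derive_mul f g x v df dg :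
  is_derive x v f df -> is_derive x v g dg ->
  is_derive x v (fun y => f y * g y) (f x * dg + g x * df).
Proof. by move=> fd gd; exact: is_deriveM. Qed.

Lemma is_derive_sub f g x v df dg :
  is_derive x v f df -> is_derive x v g dg ->
  is_derive x v (fun y => f y - g y) (df - dg).
Proof. by move=> fd gd; exact: is_deriveB. Qed.

Lemma is_derive_inv f x v df : f x != 0 -> is_derive x v f df ->
  is_derive x v (fun y => (f y)^-1) (- (f x) ^- 2 * df).
Proof.
by move=> fx [fd <-]; apply: DeriveDef; [exact: derivableV|rewrite deriveV].
Qed.

End derivation_rules.

Section derive_coordinates.
Context {R : realType}.

Lemma is_derive_coord n (x : 'rV[R]_n) (i j : 'I_n) :
  is_derive x (delta_mx 0 i) (fun y : 'rV[R]_n => y 0 j) (j == i)%:R.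
Proof.
have lim : h^-1 *: (((fun y : 'rV[R]_n => y 0 j) \o shift x) (h *: delta_mx 0 i)
    - x 0 j) @[h --> 0^'] --> ((j == i)%:R : R).
  apply: cvg_near_cst; near=> h; rewrite /= !mxE eqxx addrK.
  have h0 : h != 0 by near: h; exact: nbhs_dnbhs_neq.
  by rewrite [LHS]mulrA mulVf// mul1r.
by apply: DeriveDef; [apply/cvg_ex; eexists; exact: lim|exact: cvg_lim lim].
Unshelve. all: by end_near. Qed.

Lemma is_derive_diag_form n (c : 'I_n -> R) (x : 'rV[R]_n) (i : 'I_n) :
  is_derive x (delta_mx 0 i) (fun y : 'rV[R]_n => \sum_j c j * y 0 j ^+ 2)
    (2 * c i * x 0 i).
Proof.
rewrite (_ : (fun y : 'rV[R]_n => _) =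
    \sum_j (fun y : 'rV[R]_n => c j * (y 0 j * y 0 j))); last first.
  by apply/funext => y; rewrite fct_sumE; apply: eq_bigr.
have dsum := is_derive_sum (fun j => is_derive_mul (is_derive_cst (c j) x (delta_mx 0 i))
   (is_derive_mul (is_derive_coord x i j) (is_derive_coord x i j))).
apply: is_derive_eq dsum _.
rewrite /cst (bigD1 i)//= big1 ?addr0 => [|k /negbTE ->]; last by rewrite mulr0n; ring.
by rewrite eqxx mulr1n; ring.
Qed.

End derive_coordinates.

Section ground_state.
Context {R : realType} {n : nat} (gamma : R).
Implicit Types (x : 'rV[R]_n.+1) (i : 'I_n.+1).
Local Notation N := n.+1.

Definition sqnorm x : R := \sum_i x 0 i ^+ 2.

(** Indicator of the coordinates of [x']: with it, sums over [x'] become diagonal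
    quadratic forms in all the coordinates of [x]. *)
Definition horizontal i : R := (i != ord_max)%:R.

(** Defining function of the paraboloid, see [paraboloid_height]. *)
Definition height x : R :=
  last_rV x - gamma * \sum_i horizontal i * x 0 i ^+ 2.

Definition dheight i x : R := (i == ord_max)%:R - 2 * gamma * horizontal i * x 0 i.

(** Component [i] of - grad phi / phi, where phi = [height] * |x|^(-N/2) is the
    positive supersolution. *)
Definition ground_field i x : R :=
  N%:R / 2 * x 0 i / sqnorm x - dheight i x / height x.

(** Partial derivative of [ground_field i] along its own axis, so that the sum
    over [i] is the divergence, see [is_derive_field]. *)
Definition dground_field i x : R :=
  N%:R / 2 * ((sqnorm x)^-1 - 2 * x 0 i ^+ 2 / sqnorm x ^+ 2)
  + 2 * gamma * horizontal i / height x + dheight i x ^+ 2 / height x ^+ 2.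

Lemma is_derive_sqnorm i x : is_derive x (delta_mx 0 i) sqnorm (2 * x 0 i).
Proof.
have := is_derive_diag_form (fun=> 1) x i; rewrite mulr1.
by under eq_fun do under eq_bigr do rewrite mul1r.
Qed.

Lemma is_derive_height i x : is_derive x (delta_mx 0 i) height (dheight i x).
Proof.
refine (is_derive_eq (is_derive_sub (is_derive_coord x i ord_max)
  (is_derive_mul (is_derive_cst gamma x (delta_mx 0 i))
    (is_derive_diag_form horizontal x i))) _).
by rewrite /cst /dheight eq_sym; ring.
Qed.

Lemma is_derive_dheight i x :
  is_derive x (delta_mx 0 i) (dheight i) (- (2 * gamma * horizontal i)).
Proof.
refine (is_derive_eq (is_derive_sub (is_derive_cst ((i == ord_max)%:R : R) x (delta_mx 0 i))
  (is_derive_mul (is_derive_cst (2 * gamma * horizontal i : R) x (delta_mx 0 i))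
    (is_derive_coord x i i))) _).
by rewrite /cst eqxx mulr1n; ring.
Qed.

Lemma is_derive_field i x : sqnorm x != 0 -> height x != 0 ->
  is_derive x (delta_mx 0 i) (ground_field i) (dground_field i x).
Proof.
move=> x0 hx.
refine (is_derive_eq (is_derive_sub
  (is_derive_mul (is_derive_mul (is_derive_cst (N%:R / 2 : R) x (delta_mx 0 i))
    (is_derive_coord x i i)) (is_derive_inv x0 (is_derive_sqnorm i x)))
  (is_derive_mul (is_derive_dheight i x)
    (is_derive_inv hx (is_derive_height i x)))) _).
rewrite /cst /dground_field eqxx mulr1n; field; by rewrite x0 hx.
Qed.

Lemma continuous_at_coord x i : {for x, continuous (fun y : 'rV[R]_N => y 0 i)}.
Proof. exact: coord_continuous. Qed.

Lemma continuous_at_diag_form (c : 'I_N -> R) x :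
  {for x, continuous (fun y : 'rV[R]_N => \sum_i c i * y 0 i ^+ 2)}.
Proof.
apply: continuous_at_sum => i; apply: continuous_at_mul; first exact: cst_continuous.
by apply: continuous_at_sqr; exact: continuous_at_coord.
Qed.

Lemma continuous_at_sqnorm x : {for x, continuous sqnorm}.
Proof.
rewrite (_ : sqnorm = fun x => \sum_i 1 * x 0 i ^+ 2).
  exact: (@continuous_at_diag_form (fun=> 1)).
by apply/funext => y; apply: eq_bigr => i _; rewrite mul1r.
Qed.

Lemma continuous_at_height x : {for x, continuous height}.
Proof.
apply: continuous_at_sub; first exact: continuous_at_coord.
by apply: continuous_at_mul; [exact: cst_continuous|exact: continuous_at_diag_form].
Qed.

Lemma continuous_at_dheight i x : {for x, continuous (dheight i)}.
Proof.
apply: continuous_at_sub; first exact: cst_continuous.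
by apply: continuous_at_mul; [exact: cst_continuous|exact: continuous_at_coord].
Qed.

Lemma continuous_at_field i x : sqnorm x != 0 -> height x != 0 ->
  {for x, continuous (ground_field i)}.
Proof.
move=> x0 hx; apply: continuous_at_sub; apply: continuous_at_mul.
- by apply: continuous_at_mul; [exact: cst_continuous|exact: continuous_at_coord].
- by apply: continuous_at_inv => //; exact: continuous_at_sqnorm.
- exact: continuous_at_dheight.
- by apply: continuous_at_inv => //; exact: continuous_at_height.
Qed.

Lemma continuous_at_dfield i x : sqnorm x != 0 -> height x != 0 ->
  {for x, continuous (dground_field i)}.
Proof.
move=> x0 hx; have cs := @continuous_at_sqnorm x; have ch := @continuous_at_height x.
apply: continuous_at_add; first apply: continuous_at_add.
- apply: continuous_at_mul; first exact: cst_continuous.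
  apply: continuous_at_sub; first exact: continuous_at_inv.
  apply: continuous_at_mul; first apply: continuous_at_mul.
  + exact: cst_continuous.
  + by apply: continuous_at_sqr; exact: continuous_at_coord.
  + by apply: continuous_at_inv; [rewrite expf_eq0|exact: continuous_at_sqr].
- by apply: continuous_at_mul; [exact: cst_continuous|exact: continuous_at_inv].
- apply: continuous_at_mul; first by apply: continuous_at_sqr; exact: continuous_at_dheight.
  by apply: continuous_at_inv; [rewrite expf_eq0|exact: continuous_at_sqr].
Qed.

Lemma sum_horizontal : \sum_i horizontal i = n%:R.
Proof.
rewrite /horizontal big_ord_recr /= eqxx addr0.
under eq_bigr => j _.
  rewrite (_ : _ != _)/=; last by rewrite -val_eqE /= neq_ltn ltn_ord.
  over.
by rewrite sumr_const card_ord.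
Qed.

Lemma sum_coord_dheight x :
  \sum_i x 0 i * dheight i x
  = height x - gamma * \sum_i horizontal i * x 0 i ^+ 2.
Proof.
rewrite /dheight /height.
transitivity (\sum_i (x 0 i * (i == ord_max)%:R
   - 2 * gamma * (horizontal i * x 0 i ^+ 2))).
  by apply: eq_bigr => i _; ring.
rewrite sumrB -mulr_sumr (bigD1 ord_max)//= big1 ?addr0 => [|i /negbTE ->].
  by rewrite eqxx mulr1n /last_rV; ring.
by rewrite mulr0n mulr0.
Qed.

(** The identity div F - |F|^2 = - Laplacian phi / phi made explicit: the terms
    in |grad h|^2 / h^2 of the divergence and of the square cancel, and the cross
    term is evaluated with x . grad h = h - gamma |x'|^2
    ([sum_coord_dheight]). *)
Lemma div_field_sub_sqr x : sqnorm x != 0 -> height x != 0 ->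
  \sum_i (dground_field i x - ground_field i x ^+ 2) =
  N%:R ^+ 2 / 4 / sqnorm x
  + (2 * gamma * n%:R
     - N%:R * gamma * (\sum_i horizontal i * x 0 i ^+ 2) / sqnorm x) / height x.
Proof.
move=> x0 hx.
transitivity (\sum_i (N%:R / 2 / sqnorm x
    - (N%:R + N%:R ^+ 2 / 4) / sqnorm x ^+ 2 * x 0 i ^+ 2
    + 2 * gamma / height x * horizontal i
    + N%:R / (sqnorm x * height x) * (x 0 i * dheight i x))).
  by apply: eq_bigr => i _; rewrite /dground_field /ground_field; field; rewrite x0 hx.
rewrite !big_split /= sumrN -!mulr_sumr sum_horizontal sum_coord_dheight.
rewrite sumr_const card_ord -/(sqnorm x) -[_ *+ _]mulr_natl.
by field; rewrite x0 hx.
Qed.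

Lemma paraboloid_height x : paraboloid gamma x -> 0 < height x.
Proof.
rewrite /paraboloid /= subr_gt0; congr (gamma * _ < _).
rewrite /enorm sqr_sqrtr; last by apply: sumr_ge0 => i _; exact: sqr_ge0.
rewrite [RHS]big_ord_recr /= /horizontal eqxx mul0r addr0.
apply: eq_bigr => j _; rewrite mxE (_ : _ != _) ?mul1r//.
by rewrite -val_eqE /= neq_ltn ltn_ord.
Qed.

End ground_state.

(** * The inequality for test functions *)

Section pointwise.
Context {R : realType} {n : nat} (gamma : R).
Implicit Types (x : 'rV[R]_n.+1) (i : 'I_n.+1).
Local Notation N := n.+1.
Local Notation height := (height gamma).
Local Notation ground_field := (ground_field gamma).
Local Notation dground_field := (dground_field gamma).

(** The two potentials of the Hardy inequality, with the constant [n - 1]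
    standing for N - 2. *)
Definition weight x : R :=
  N%:R ^+ 2 / 4 / enorm x ^+ 2 + gamma * (n%:R - 1) / enorm x.

Lemma enorm_sqr x : enorm x ^+ 2 = sqnorm x.
Proof. by rewrite sqr_sqrtr// sumr_ge0// => i _; exact: sqr_ge0. Qed.

Lemma height_le_enorm x : 0 <= gamma -> height x <= enorm x.
Proof.
move=> g0; apply: (@le_trans _ _ (last_rV x)).
  rewrite lerBlDr lerDl mulr_ge0// sumr_ge0// => i _.
  by rewrite mulr_ge0 ?sqr_ge0// ler0n.
rewrite (le_trans (ler_norm _))// -sqrtr_sqr ler_wsqrtr//.
by rewrite (bigD1 ord_max)//= lerDl sumr_ge0// => i _; exact: sqr_ge0.
Qed.

Lemma horizontal_le_sqnorm x :
  \sum_i @horizontal R n i * x 0 i ^+ 2 <= sqnorm x.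
Proof.
apply: ler_sum => i _; rewrite /horizontal; case: (i != _).
  by rewrite mul1r.
by rewrite mul0r sqr_ge0.
Qed.

(** Since |x'| <= |x|, the numerator
    2 gamma (N - 1) - N gamma |x'|^2 / |x|^2 over h is at least gamma (N - 2),
    which is nonnegative for N >= 2; and h <= x_N <= |x|. *)
Lemma weight_le_div_field x : (0 < n)%N -> 0 < gamma -> paraboloid gamma x ->
  weight x <= \sum_i (dground_field i x - ground_field i x ^+ 2).
Proof.
move=> n0 g0 Px; have h0 := paraboloid_height Px.
have hr := height_le_enorm x (ltW g0); have r0 := lt_le_trans h0 hr.
have s0 : 0 < sqnorm x by rewrite -enorm_sqr exprn_gt0.
rewrite div_field_sub_sqr ?gt_eqF// /weight enorm_sqr lerD2l.
have n1 : 1 <= n%:R :> R by rewrite ler1n.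
have s1 : (\sum_i @horizontal R n i * x 0 i ^+ 2) / sqnorm x <= 1.
  by rewrite ler_pdivrMr// mul1r horizontal_le_sqnorm.
apply: (@le_trans _ _ (gamma * (n%:R - 1) / height x)).
  rewrite ler_wpM2l ?lef_pV2//; nra.
rewrite ler_wpM2r ?invr_ge0 ?(ltW h0)//.
move: s1; rewrite -[_ * _ / sqnorm x]mulrA; move: (_ / sqnorm x) => t t1.
rewrite -subr_ge0 [leRHS](_ : _ = N%:R * gamma * (1 - t)).
  by rewrite mulr_ge0 ?subr_ge0// mulr_ge0 ?ler0n ?(ltW g0).
by rewrite -natr1; ring.
Qed.

(** Expansion of |d + w F|^2 >= 0. The last sum is div (w^2 F) when [d] is the
    gradient of [w]. *)
Lemma sum_sqr_field_lower x (w : R) (d : 'I_n.+1 -> R) :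
  w ^+ 2 * (\sum_i (dground_field i x - ground_field i x ^+ 2)) <=
  \sum_i d i ^+ 2 + \sum_i w * (2 * d i * ground_field i x + w * dground_field i x).
Proof.
rewrite mulr_sumr -big_split /=; apply: ler_sum => i _.
rewrite -subr_ge0 [leRHS](_ : _ = (d i + w * ground_field i x) ^+ 2); first exact: sqr_ge0.
by ring.
Qed.

Lemma continuous_at_enorm x : {for x, continuous (@enorm R N)}.
Proof. by apply: continuous_comp; [exact: continuous_at_sqnorm|exact: sqrt_continuous]. Qed.

Lemma continuous_at_weight x : enorm x != 0 -> {for x, continuous weight}.
Proof.
move=> x0; apply: continuous_at_add; apply: continuous_at_mul.
- exact: cst_continuous.
- apply: continuous_at_inv; first by rewrite expf_eq0.
  by apply: continuous_at_sqr; exact: continuous_at_enorm.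
- exact: cst_continuous.
- by apply: continuous_at_inv => //; exact: continuous_at_enorm.
Qed.

End pointwise.

Section cutoff.
Context {R : realType} {V : normedModType R}.

(** Off [A] the product vanishes near [x], whatever [f] does there. This extends
    quantities that are only regular on the paraboloid to the whole space. *)
Lemma continuous_supported_mul (A : set V) (w f : V -> R) : closed A ->
  continuous w -> (forall x, ~ A x -> w x = 0) ->
  (forall x, A x -> {for x, continuous f}) ->
  continuous (fun x => w x * f x).
Proof.
move=> cA cw w0 cf x; have [Ax|nAx] := pselect (A x).
  by apply: continuous_at_mul; [exact: cw|exact: cf].
rewrite /continuous_at w0// mul0r; apply: cvg_near_cst.
have : nbhs x (~` A) by apply: open_nbhs_nbhs; split=> //; exact: closed_openC.
by apply: filterS => y /w0 ->; rewrite mul0r.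
Qed.

Lemma is_derive_supported_mul (A : set V) (w f : V -> R) x v dw df : closed A ->
  (forall y, ~ A y -> w y = 0) -> is_derive x v w dw ->
  (A x -> is_derive x v f df) ->
  is_derive x v (fun y => w y ^+ 2 * f y) (w x * (2 * dw * f x + w x * df)).
Proof.
move=> cA w0 wd fd; have [Ax|nAx] := pselect (A x).
  apply: is_derive_eq (is_derive_mul (is_derive_mul wd wd) (fd Ax)) _.
  by ring.
rewrite w0// mul0r; apply: (@near_eq_is_derive _ _ _ (cst 0)).
have : nbhs x (~` A) by apply: open_nbhs_nbhs; split=> //; exact: closed_openC.
by apply: filterS => y /w0 ->; rewrite expr0n mul0r.
Qed.

End cutoff.

Section hardy_test_function.
Context {R : realType} {n : nat} (gamma : R) (Omega : set 'rV[R]_n.+1).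
Local Notation N := n.+1.
Local Notation mu := (@lebesgue_rV R N).
Hypotheses (n0 : (0 < n)%N) (gamma0 : 0 < gamma) (oOmega : open Omega)
  (OmegaP : Omega `<=` paraboloid gamma).

Lemma height_enorm_gt0 x : Omega x -> 0 < height gamma x /\ 0 < enorm x.
Proof.
move=> /OmegaP/paraboloid_height h0; split=> //.
by apply: lt_le_trans h0 _; exact: height_le_enorm (ltW gamma0).
Qed.

Lemma weight_ge0 (x : 'rV[R]_N) : 0 <= weight gamma x.
Proof.
rewrite addr_ge0// divr_ge0 ?sqr_ge0 ?divr_ge0 ?sqr_ge0 ?sqrtr_ge0//.
by rewrite mulr_ge0 ?(ltW gamma0)// subr_ge0 ler1n.
Qed.

Lemma measurable_weight : measurable_fun Omega (weight gamma).
Proof.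
apply: continuous_measurable_rV => // x; rewrite inE => /height_enorm_gt0[_ r0].
by apply: continuous_at_weight; rewrite gt_eqF.
Qed.

(** The divergence of w^2 F is supported in the support of [w], so its integral
    over the domain is the one over the whole space, which is zero. *)
Lemma hardy_test_function w : test_function Omega w ->
  (\int[mu]_(x in Omega) (weight gamma x * w x ^+ 2)%:E <=
   \int[mu]_(x in Omega) (enorm (grad w x) ^+ 2)%:E)%E.
Proof.
move=> [smw cA AO]; set A := closure _ in cA AO.
have mO : measurable Omega by exact: open_measurable_rV.
have [cw dw] := smw 1%N.
have clA : closed A by exact: closed_closure.
have w0 x : ~ A x -> w x = 0.
  move=> Ax; apply/eqP/negPn/negP => wx; apply: Ax; exact: subset_closure.
have A_gt0 x : A x -> sqnorm x != 0 /\ height gamma x != 0.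
  by move=> /AO/height_enorm_gt0[? ?]; rewrite -enorm_sqr expf_eq0/= !gt_eqF.
(* G i is the i-th partial derivative of w^2 F_i. *)
pose G i x := w x * (2 * 'D_(delta_mx 0 i) w x * ground_field gamma i x
                     + w x * dground_field gamma i x).
have cG i : continuous (G i).
  apply: (continuous_supported_mul clA) => // x /A_gt0[s0 h0].
  apply: continuous_at_add; apply: continuous_at_mul.
  - apply: continuous_at_mul; first exact: cst_continuous.
    by have [_ [cD _]] := dw i; exact: cD.
  - exact: continuous_at_field.
  - exact: cw.
  - exact: continuous_at_dfield.
have G0 i x : ~ A x -> G i x = 0 by move=> /w0 wx; rewrite /G wx mul0r.
have intG i : mu.-integrable setT (EFin \o G i).
  exact: integrable_compact_supp cA (cG i) (G0 i).
have zG i : (\int[mu]_x (G i x)%:E = 0)%E.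
  apply: (@integral_derive0 _ _ A (fun y => w y ^+ 2 * ground_field gamma i y) _ i) => //.
    move=> x; apply: (is_derive_supported_mul clA) => //.
      by apply/derivableP; have [/(_ x)] := dw i.
    by move=> /A_gt0[s0 h0]; exact: is_derive_field.
  by move=> x Ax; split; [rewrite (w0 x Ax) expr0n mul0r|exact: G0].
pose S x := \sum_i G i x.
have SE : EFin \o S = (fun x => \sum_i (G i x)%:E)%E.
  by apply/funext => x; rewrite /S /= sumEFin.
have intS : mu.-integrable setT (EFin \o S).
  by rewrite SE; apply: integrable_sum => // i _; exact: intG.
have zS : (\int[mu]_(x in Omega) (S x)%:E = 0)%E.
  transitivity (\int[mu]_x (S x)%:E)%E.
    rewrite integral_mkcond; apply: eq_integral => x _; rewrite patchE.
    case: ifPn => // /negP xO; rewrite /S big1// => i _; apply: G0 => Ax.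
    by apply: xO; rewrite inE; exact: AO.
  rewrite -[LHS]/(\int[mu]_x (EFin \o S) x)%E SE integral_sum//.
  by apply: big1 => i _; exact: zG.
have mq : measurable_fun Omega (fun x => enorm (grad w x) ^+ 2).
  apply: measurable_funTS; apply: continuous_measurableT_rV => x.
  rewrite (_ : (fun x => _) = fun x => \sum_i ('D_(delta_mx 0 i) w x) ^+ 2).
    by apply: continuous_at_sum => i; apply: continuous_at_sqr; have [_ [cD _]] := dw i; exact: cD.
  by apply/funext => y; rewrite enorm_sqr; apply: eq_bigr => i _; rewrite mxE.
have q0 x : 0 <= enorm (grad w x) ^+ 2 by exact: sqr_ge0.
(* An infinite Dirichlet integral makes the claim trivial, which spares the
   compact support of the gradient. *)
have [->|qoo] := eqVneq (\int[mu]_(x in Omega) (enorm (grad w x) ^+ 2)%:E)%E +oo%E.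
  exact: leey.
have intq : mu.-integrable Omega (fun x => (enorm (grad w x) ^+ 2)%:E).
  apply/integrableP; split; first exact/measurable_EFinP.
  rewrite (eq_integral (fun x => (enorm (grad w x) ^+ 2)%:E)); first by rewrite ltey.
  by move=> x _; rewrite gee0_abs ?lee_fin.
have intSO : mu.-integrable Omega (EFin \o S) by exact: integrableS intS.
rewrite -[leRHS]adde0 -zS -integralD//.
have mw : measurable_fun Omega w by apply: measurable_funTS; exact: continuous_measurableT_rV.
apply: ge0_le_integral => //.
- by move=> x _; rewrite lee_fin mulr_ge0 ?weight_ge0 ?sqr_ge0.
- apply/measurable_EFinP; apply: measurable_funM; first exact: measurable_weight.
  exact: measurable_funX.
- by apply: emeasurable_funD; [exact/measurable_EFinP|exact: measurable_int intSO].
move=> x Ox; rewrite lee_fin mulrC.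
rewrite (_ : enorm _ ^+ 2 = \sum_i ('D_(delta_mx 0 i) w x) ^+ 2); last first.
  by rewrite enorm_sqr; apply: eq_bigr => i _; rewrite mxE.
apply: le_trans (sum_sqr_field_lower gamma x (w x) _).
by rewrite ler_wpM2l ?sqr_ge0//; apply: weight_le_div_field => //; exact: OmegaP.
Qed.

End hardy_test_function.

(** * Passage to the closure and the theorem *)

Section quadratic_perturbation.
Context {R : realFieldType}.

(** Young's inequality: the defect is the square (eps b - (a - b))^2 / eps. *)
Lemma sqr_le_perturb (eps a b : R) : 0 < eps ->
  a ^+ 2 <= (1 + eps) * b ^+ 2 + (1 + eps^-1) * (a - b) ^+ 2.
Proof.
move=> e0; rewrite -subr_ge0 [leRHS](_ : _ = (eps * b - (a - b)) ^+ 2 / eps).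
  by rewrite divr_ge0 ?sqr_ge0 ?(ltW e0).
by field; rewrite gt_eqF.
Qed.

End quadratic_perturbation.

Lemma enorm_sqr_le_perturb {R : realType} n (eps : R) (a b : 'rV[R]_n.+1) : 0 < eps ->
  enorm a ^+ 2 <= (1 + eps) * enorm b ^+ 2 + (1 + eps^-1) * enorm (a - b) ^+ 2.
Proof.
move=> e0; rewrite !enorm_sqr /sqnorm !mulr_sumr -big_split /=.
by apply: ler_sum => i _; rewrite !mxE; exact: sqr_le_perturb.
Qed.

Section nonneg_integral.
Context {d : measure_display} {T : measurableType d} {R : realType}
  (mu : {measure set T -> \bar R}) (D : set T).

Lemma le_integral_lincomb (f f1 f2 : T -> R) (a b : R) : measurable D ->
  measurable_fun D f -> measurable_fun D f1 -> measurable_fun D f2 ->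
  (forall x, D x -> 0 <= f x) -> (forall x, D x -> 0 <= f1 x) ->
  (forall x, D x -> 0 <= f2 x) -> 0 <= a -> 0 <= b ->
  (forall x, D x -> f x <= a * f1 x + b * f2 x) ->
  (\int[mu]_(x in D) (f x)%:E <=
   a%:E * \int[mu]_(x in D) (f1 x)%:E + b%:E * \int[mu]_(x in D) (f2 x)%:E)%E.
Proof.
move=> mD mf mf1 mf2 f0 f10 f20 a0 b0 le_f.
have mE1 := iffRL (measurable_EFinP D f1) mf1.
have mE2 := iffRL (measurable_EFinP D f2) mf2.
rewrite -!ge0_integralZl_EFin//.
have p1 x : D x -> (0 <= a%:E * (f1 x)%:E)%E.
  by move=> Dx; rewrite lee_fin mulr_ge0// f10.
have p2 x : D x -> (0 <= b%:E * (f2 x)%:E)%E.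
  by move=> Dx; rewrite lee_fin mulr_ge0// f20.
have m1 : measurable_fun D (fun x => (a%:E * (f1 x)%:E)%E) by exact: measurable_funeM.
have m2 : measurable_fun D (fun x => (b%:E * (f2 x)%:E)%E) by exact: measurable_funeM.
rewrite -ge0_integralD//; apply: ge0_le_integral => //.
- exact/measurable_EFinP.
- exact: emeasurable_funD.
Qed.

(** Monotone convergence: at each point the truncation is inactive once the level
    exceeds the weight. *)
Lemma le_integral_truncated (W v : T -> R) (J : \bar R) : measurable D ->
  measurable_fun D W -> measurable_fun D v -> (forall x, D x -> 0 <= W x) ->
  (forall k : nat,
    (\int[mu]_(x in D) (Num.min (W x) k%:R * v x ^+ 2)%:E <= J)%E) ->
  (\int[mu]_(x in D) (W x * v x ^+ 2)%:E <= J)%E.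
Proof.
move=> mD mW mv W0 leJ.
pose g k x := (Num.min (W x) k%:R * v x ^+ 2)%:E.
have limg x : limn (g ^~ x) = (W x * v x ^+ 2)%:E.
  apply: cvg_lim => //; apply: cvg_near_cst; near=> k; rewrite /g min_l//.
  by rewrite ltW//; near: k; exact: nbhs_infty_gtr.
have mg k : measurable_fun D (g k).
  apply/measurable_EFinP; apply: measurable_funM; last exact: measurable_funX.
  exact: measurable_minr.
have g0 k x : D x -> (0 <= g k x)%E.
  by move=> Dx; rewrite lee_fin mulr_ge0 ?sqr_ge0// le_min W0/=.
have gnd x : D x -> {homo g ^~ x : k l / (k <= l)%N >-> (k <= l)%E}.
  move=> Dx k l kl; rewrite lee_fin ler_wpM2r ?sqr_ge0//.
  by rewrite le_min ge_min lexx/= ge_min ler_nat kl orbT.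
have cvgI : (\int[mu]_(x in D) g k x @[k --> \oo] -->
    \int[mu]_(x in D) limn (g ^~ x))%E by exact: cvg_monotone_convergence.
rewrite (eq_integral (fun x => limn (g ^~ x))) => [|x _]; last by rewrite limg.
rewrite -(cvg_lim _ cvgI)//; apply: lime_le; first by apply/cvg_ex; eexists; exact: cvgI.
by apply: nearW => k; exact: leJ.
Unshelve. all: by end_near. Qed.

End nonneg_integral.

(** The bound of [hardy_H10] with error [delta] and Young parameter [eps]: taking
    delta = eps^2 / (1 + M) absorbs the factors 1 / eps and M, so that for
    eps <= 1 the excess over [j] is at most eps (3 j + 6). *)
Lemma perturbed_le {R : realType} (I : \bar R) (j M : R) : 0 <= j -> 0 <= M ->
  (forall eps delta : R, 0 < eps -> 0 < delta ->
    (I <= ((1 + eps) * ((1 + eps) * j + (1 + eps^-1) * delta)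
           + (1 + eps^-1) * M * delta)%:E)%E) -> (I <= j%:E)%E.
Proof.
move=> j0 M0 leI; apply/lee_addgt0Pr => eta eta0.
have K0 : 0 < 3 * j + 6 by lra.
pose eps := Num.min 1 (eta / (3 * j + 6)).
have e0 : 0 < eps by rewrite lt_min ltr01/= divr_gt0.
have e1 : eps <= 1 by rewrite ge_min lexx.
have eK : eps * (3 * j + 6) <= eta.
  by rewrite -ler_pdivlMr// ge_min lexx orbT.
have M1 : 0 < 1 + M by lra.
apply: (le_trans (leI eps (eps ^+ 2 / (1 + M)) e0 _)).
  by rewrite divr_gt0 ?exprn_gt0.
rewrite -EFinD lee_fin.
rewrite [leLHS](_ : _ = (1 + eps) ^+ 2 * j + (1 + eps) * eps
   + (1 + eps) * eps * (eps / (1 + M))).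
  have t0 : 0 <= eps / (1 + M) by rewrite divr_ge0 ?(ltW e0) ?(ltW M1).
  have t1 : eps / (1 + M) <= 1 by rewrite ler_pdivrMr// mul1r; lra.
  move: (eps / (1 + M)) t0 t1 => t t0 t1; nra.
field; rewrite !gt_eqF//.
Qed.

Section hardy_closure.
Context {R : realType} {n : nat} (gamma : R) (Omega : set 'rV[R]_n.+1).
Local Notation N := n.+1.
Local Notation mu := (@lebesgue_rV R N).
Hypotheses (n0 : (0 < n)%N) (gamma0 : 0 < gamma) (oOmega : open Omega)
  (OmegaP : Omega `<=` paraboloid gamma).

Lemma measurable_enorm_sqr (D : set 'rV[R]_N) (g : 'rV[R]_N -> 'rV[R]_N) :
  (forall i, measurable_fun D (fun x => g x 0 i)) ->
  measurable_fun D (fun x => enorm (g x) ^+ 2).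
Proof.
move=> mg; rewrite (_ : (fun x => _) = fun x => \sum_i g x 0 i ^+ 2).
  by apply: measurable_sum => i; exact: measurable_funX.
by apply/funext => x; rewrite enorm_sqr.
Qed.

Lemma integral_enorm_sqr_lty (g : 'rV[R]_N -> 'rV[R]_N) :
  (forall i, inL2 Omega (fun x => g x 0 i)) ->
  (\int[mu]_(x in Omega) (enorm (g x) ^+ 2)%:E < +oo)%E.
Proof.
move=> gL2; have mO : measurable Omega by exact: open_measurable_rV.
rewrite (eq_integral (fun x => \sum_i (g x 0 i ^+ 2)%:E)%E); last first.
  by move=> x _; rewrite sumEFin enorm_sqr.
rewrite ge0_integral_sum//.
- by apply: lte_sum_pinfty => i _; have [] := gL2 i.
- by move=> i; apply/measurable_EFinP; apply: measurable_funX; have [] := gL2 i.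
- by move=> i x _; rewrite lee_fin sqr_ge0.
Qed.

Lemma integral_weight (v : 'rV[R]_N -> R) : measurable_fun Omega v ->
  (\int[mu]_(x in Omega) (weight gamma x * v x ^+ 2)%:E =
   (N%:R ^+ 2 / 4)%:E * \int[mu]_(x in Omega) (v x ^+ 2 / enorm x ^+ 2)%:E +
   (gamma * (n%:R - 1))%:E * \int[mu]_(x in Omega) (v x ^+ 2 / enorm x)%:E)%E.
Proof.
move=> mv; have mO : measurable Omega by exact: open_measurable_rV.
have r0 x : Omega x -> 0 < enorm x by move=> /(height_enorm_gt0 gamma0 OmegaP)[].
have mv2 : measurable_fun Omega (fun x => v x ^+ 2) by exact: measurable_funX.
have mr : measurable_fun Omega (fun x : 'rV[R]_N => (enorm x)^-1).
  apply: continuous_measurable_rV => // x; rewrite inE => /r0 rx.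
  by apply: continuous_at_inv; [rewrite gt_eqF|exact: continuous_at_enorm].
have m1 : measurable_fun Omega (fun x => (v x ^+ 2 / enorm x)%:E).
  by apply/measurable_EFinP; exact: measurable_funM.
have m2 : measurable_fun Omega (fun x => (v x ^+ 2 / enorm x ^+ 2)%:E).
  apply/measurable_EFinP; apply: measurable_funM => //.
  by under eq_fun do rewrite -exprVn; exact: measurable_funX.
have p1 x : Omega x -> (0 <= (v x ^+ 2 / enorm x)%:E)%E.
  by move=> /r0 rx; rewrite lee_fin divr_ge0 ?sqr_ge0// ltW.
have p2 x : Omega x -> (0 <= (v x ^+ 2 / enorm x ^+ 2)%:E)%E.
  by move=> _; rewrite lee_fin divr_ge0 ?sqr_ge0.
have k1 : 0 <= gamma * (n%:R - 1) by rewrite mulr_ge0 ?(ltW gamma0)// subr_ge0 ler1n.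
have k2 : 0 <= N%:R ^+ 2 / 4 :> R by rewrite divr_ge0 ?sqr_ge0.
rewrite -!ge0_integralZl_EFin// -ge0_integralD//.
- by apply: eq_integral => x _; rewrite -!EFinM -EFinD; congr EFin; rewrite /weight; ring.
- by move=> x Ox; rewrite mule_ge0 ?p2.
- exact: measurable_funeM.
- by move=> x Ox; rewrite mule_ge0 ?p1.
- exact: measurable_funeM.
Qed.

(** Compare [v] with a test function [phi k] close in H^1: by Young's inequality
    the truncated left-hand side for [v] is at most (1 + eps) times the one for
    [phi k] plus an error, the test function inequality bounds the latter by the
    Dirichlet integral of [phi k], which is (1 + eps) times that of [v] plus an
    error. *)
Lemma hardy_H10 v g : inH10 Omega v g ->
  (\int[mu]_(x in Omega) (weight gamma x * v x ^+ 2)%:E <=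
   \int[mu]_(x in Omega) (enorm (g x) ^+ 2)%:E)%E.
Proof.
move=> [[[mv _] gL2 _] [phi [tphi phiv]]].
have mO : measurable Omega by exact: open_measurable_rV.
have mg i : measurable_fun Omega (fun x => g x 0 i) by have [] := gL2 i.
have mW := measurable_weight gamma0 oOmega OmegaP.
have W0 := weight_ge0 n0 gamma0.
have mphi k : measurable_fun Omega (phi k).
  by have [/(_ 0%N)[cphi _] _ _] := tphi k;
    apply: measurable_funTS; exact: continuous_measurableT_rV.
have mdphi k i : measurable_fun Omega (fun x => grad (phi k) x 0 i).
  have [/(_ 1%N)[_ /(_ i)[_ [cD _]]] _ _] := tphi k.
  apply: measurable_funTS; apply: continuous_measurableT_rV.
  by rewrite (_ : (fun x => _) = 'D_(delta_mx 0 i) (phi k))//; apply/funext => x; rewrite mxE.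
have mq k : measurable_fun Omega (fun x => enorm (grad (phi k) x) ^+ 2).
  exact: measurable_enorm_sqr.
have mdq k : measurable_fun Omega (fun x => enorm (grad (phi k) x - g x) ^+ 2).
  apply: measurable_enorm_sqr => i; under eq_fun do rewrite !mxE.
  apply: measurable_funB => //.
  by have := mdphi k i; under eq_fun do rewrite mxE.
pose err k x := (phi k x - v x) ^+ 2 + enorm (grad (phi k) x - g x) ^+ 2.
have merr k : measurable_fun Omega (err k).
  by apply: measurable_funD => //; apply: measurable_funX; exact: measurable_funB.
have err0 k x : 0 <= err k x by rewrite addr_ge0 ?sqr_ge0.
have mgq : measurable_fun Omega (fun x => enorm (g x) ^+ 2) by exact: measurable_enorm_sqr.
have Joo := integral_enorm_sqr_lty gL2.
have J0 : (0 <= \int[mu]_(x in Omega) (enorm (g x) ^+ 2)%:E)%E.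
  by apply: integral_ge0 => x _; rewrite lee_fin sqr_ge0.
have mWphi k : measurable_fun Omega (fun x => weight gamma x * phi k x ^+ 2).
  by apply: measurable_funM => //; exact: measurable_funX.
apply: le_integral_truncated => // M.
have mWv : measurable_fun Omega (fun x => Num.min (weight gamma x) M%:R * v x ^+ 2).
  by apply: measurable_funM; [exact: measurable_minr|exact: measurable_funX].
have Jfin : (\int[mu]_(x in Omega) (enorm (g x) ^+ 2)%:E)%E \is a fin_num.
  by rewrite ge0_fin_numE.
rewrite -(fineK Jfin); apply: (@perturbed_le _ _ _ M%:R) => //; first exact: fine_ge0.
move=> eps delta e0 d0.
have c0 : 0 <= 1 + eps by rewrite addr_ge0// ltW.
have c1 : 0 <= 1 + eps^-1 by rewrite addr_ge0// invr_ge0 ltW.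
have [k ek] : exists k, (\int[mu]_(x in Omega) (err k x)%:E <= delta%:E)%E.
  have /phiv[k _ ek] : nbhs (0 : \bar R)%E [set y | (y < delta%:E)%E].
    by apply: open_nbhs_nbhs; split; [exact: open_ereal_lt_ereal|rewrite /= lte_fin].
  by exists k; apply: ltW; exact: ek (leqnn k).
have step1 := @le_integral_lincomb _ _ R mu Omega _ _ (err k) (1 + eps)
  ((1 + eps^-1) * M%:R) mO mWv (mWphi k) (merr k).
have step2 := @le_integral_lincomb _ _ R mu Omega _ _ (err k) (1 + eps)
  (1 + eps^-1) mO (mq k) mgq (merr k).
apply: (le_trans (step1 _ _ _ _ _ _)) => //.
- by move=> x _; rewrite mulr_ge0 ?sqr_ge0// le_min W0/=.
- by move=> x _; rewrite mulr_ge0 ?sqr_ge0.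
- by rewrite mulr_ge0.
- move=> x _; apply: (@le_trans _ _ (Num.min (weight gamma x) M%:R *
    ((1 + eps) * phi k x ^+ 2 + (1 + eps^-1) * (phi k x - v x) ^+ 2))).
    rewrite ler_wpM2l ?le_min ?W0//=.
    by rewrite -[X in _ + _ * X]sqrrN opprB; exact: sqr_le_perturb.
  rewrite mulrDr lerD//.
    rewrite mulrCA ler_wpM2l// ler_wpM2r ?sqr_ge0//.
    by rewrite ge_min lexx.
  rewrite mulrCA -mulrA ler_wpM2l// ler_pM ?le_min ?W0 ?sqr_ge0 ?ler0n//.
    by rewrite ge_min lexx orbT.
  by rewrite lerDl sqr_ge0.
rewrite [leRHS]EFinD leeD//; last by rewrite [leRHS]EFinM lee_wpmul2l// lee_fin mulr_ge0.
rewrite [leRHS]EFinM lee_wpmul2l//.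
apply: (le_trans (hardy_test_function n0 gamma0 oOmega OmegaP (tphi k))).
apply: (le_trans (step2 _ _ _ _ _ _)) => //.
- by move=> x _; exact: sqr_ge0.
- by move=> x _; exact: sqr_ge0.
- move=> x _; apply: le_trans (enorm_sqr_le_perturb _ (g x) e0) _.
  by rewrite lerD2l ler_wpM2l// lerDr sqr_ge0.
by rewrite [leRHS]EFinD leeD ?[leRHS]EFinM ?fineK// lee_wpmul2l.
Qed.

End hardy_closure.

Unset Implicit Arguments.

Theorem theorem2p1 (R : realType) (n : nat) (gamma : R)
    (Omega : set 'rV[R]_n.+1) :
  let N := n.+1 in
  let mu := @lebesgue_rV R N in
  0 < gamma ->
  lipschitz_domain Omega ->
  boundary Omega 0 ->
  smooth_boundary_near Omega 0 ->
  Omega `<=` paraboloid gamma ->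
  ((3 <= N)%N ->
    exists2 C : R, 0 < C &
      forall (v : 'rV[R]_N -> R) (grad_v : 'rV[R]_N -> 'rV[R]_N),
        inH10 Omega v grad_v ->
        (\int[mu]_(x in Omega) (enorm (grad_v x) ^+ 2)%:E
         - (N%:R ^+ 2 / 4)%:E *
           \int[mu]_(x in Omega) (v x ^+ 2 / enorm x ^+ 2)%:E
         >= C%:E * \int[mu]_(x in Omega) (v x ^+ 2 / enorm x)%:E)%E) /\
  (N = 2%N ->
    forall (v : 'rV[R]_N -> R) (grad_v : 'rV[R]_N -> 'rV[R]_N),
      inH10 Omega v grad_v ->
      (\int[mu]_(x in Omega) (enorm (grad_v x) ^+ 2)%:E
       >= (N%:R ^+ 2 / 4)%:E *
          \int[mu]_(x in Omega) (v x ^+ 2 / enorm x ^+ 2)%:E)%E).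
Proof.
move=> N mu gamma0 [[oO _ _] _] _ _ OP.
split=> [n2|n1].
  have n0 : (0 < n)%N by rewrite (@leq_trans 2).
  exists (gamma * (n%:R - 1)); first by rewrite mulr_gt0// subr_gt0 ltr1n.
  move=> v g vH; have := hardy_H10 n0 gamma0 oO OP vH.
  rewrite (integral_weight n0 gamma0 oO OP); last by have [[[]]] := vH.
  have gL2 : forall i, inL2 Omega (fun x => g x 0 i) by have [[]] := vH.
  have Joo := integral_enorm_sqr_lty oO gL2.
  move=> le_J; rewrite leeBrDl//.
  rewrite ge0_fin_numE; last first.
    rewrite mule_ge0 ?lee_fin ?divr_ge0 ?sqr_ge0//.
    by apply: integral_ge0 => x _; rewrite lee_fin divr_ge0 ?sqr_ge0.
  apply: le_lt_trans Joo; apply: le_trans le_J; rewrite leeDl// mule_ge0//.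
    by rewrite lee_fin mulr_ge0 ?(ltW gamma0)// subr_ge0 ler1n.
  by apply: integral_ge0 => x _; rewrite lee_fin divr_ge0 ?sqr_ge0 ?sqrtr_ge0.
have n0 : (0 < n)%N by move: n1 => [->].
move=> v g vH; apply: le_trans (hardy_H10 n0 gamma0 oO OP vH).
rewrite (integral_weight n0 gamma0 oO OP); last by have [[[]]] := vH.
rewrite leeDl// mule_ge0//.
  by rewrite lee_fin mulr_ge0 ?(ltW gamma0)// subr_ge0 ler1n.
by apply: integral_ge0 => x _; rewrite lee_fin divr_ge0 ?sqr_ge0 ?sqrtr_ge0.
Qed.
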